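(* Let $A=(\mathbf{a}_1,\ldots,\mathbf{a}_n)\in\mathbb{X}^{m\times n}$ be a column regular matrix and $\mathbf{d}\in\mathbb{X}^m$ a nonzero vector such that $A$ is consistent with $\mathbf{d}$. Let $\mathcal{I}$ be the set of all index sets $I\subseteq\{1,\ldots,n\}$ such that the columns $\{\mathbf{a}_i: i\in I\}$ form a minimal generating system for $\mathbf{d}$. Then the general solution of the equation $A\mathbf{x}=\mathbf{d}$ is the (possibly empty) family $\{\mathbf{x}_I: I\in\mathcal{I}\}$, where $\mathbf{x}_I=(x_i)$ is given by $$x_i=(\mathbf{d}^-\mathbf{a}_i)^-\ \text{ if } i\in I,\qquad x_i\le(\mathbf{d}^-\mathbf{a}_i)^-\ \text{ if } i\notin I;$$ that is, $\mathbf{x}\in\mathbb{X}^n$ satisfies $A\mathbf{x}=\mathbf{d}$ if and only if there is $I\in\mathcal{I}$ for which the components of $\mathbf{x}$ satisfy these conditions.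
   Context: $\langle\mathbb{X},\mathbf{0},\mathbf{1},\oplus,\otimes\rangle$ is a linearly ordered radicable idempotent semifield: a commutative semiring with zero $\mathbf{0}$ and identity $\mathbf{1}\neq\mathbf{0}$ in which $x\oplus x=x$ for all $x$, every nonzero $x$ has a multiplicative inverse $x^{-1}$, the power $x^q$ is defined for every nonzero $x$ and rational $q$ (every nonzero element has roots of all orders), and the relation $x\le y\iff x\oplus y=y$ is a total order. The sign $\otimes$ is omitted. Vector and matrix operations over $\mathbb{X}$ follow the usual rules with $\oplus,\otimes$ in place of $+,\times$. For a column vector $\mathbf{x}=(x_i)$, $\mathbf{x}^-$ is the row vector with components $x_i^-=x_i^{-1}$ if $x_i\neq\mathbf{0}$ and $x_i^-=\mathbf{0}$ otherwise; for a scalar, likewise $x^-=x^{-1}$ if $x\ne\mathbf{0}$ and $\mathbf{0}^-=\mathbf{0}$. A matrix is column regular if it has no zero columns. Consistency: let $K=\{i: d_i=\mathbf{0}\}$ and $J=\{j: a_{ij}>\mathbf{0}\text{ for some } i\in K\}$. $A=(a_{ij})$ is consistent with $\mathbf{d}$ if $a_{ij}=\mathbf{0}$ whenever $i\notin K$ and $j\in J$. A system of nonzero vectors is a minimal generating system for $\mathbf{d}$ if $\mathbf{d}$ is a linear combination of the vectors of the system with coefficients in $\mathbb{X}$, and $\mathbf{d}$ is not a linear combination of the vectors of any proper subsystem (the empty system has only the zero vector as a combination). *)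

(* Defs.v *)
From HB Require Import structures.
From mathcomp Require Import all_boot all_order all_algebra.

Set Implicit Arguments.
Unset Strict Implicit.
Unset Printing Implicit Defensive.

Import Order.TTheory GRing.Theory.
Local Open Scope ring_scope.

(* Linearly ordered radicable idempotent semifields; the semiring operations  *)
(* + and * play the role of oplus and otimes.  The value of [sinv] at 0 is    *)
(* irrelevant.  [adds_total] is the totality of the relation x + y = y; its   *)
(* other order properties follow from the semiring laws and [addss] and are   *)
(* proved below.  A linearly ordered group is torsion-free, so the roots      *)
(* given by [radicable] are unique and all rational powers of nonzero         *)
(* elements are determined.                                                   *)
HB.mixin Record isIdempotentSemifield X of GRing.ComNzSemiRing X := {
  sinv : X -> X;
  mulfsV : forall x : X, x != 0 -> x * sinv x = 1;
  addss : forall x : X, x + x = x;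
  adds_total : forall x y : X, x + y = y \/ y + x = x;
  radicable : forall (x : X) (k : nat), x != 0 -> (0 < k)%N ->
    exists y : X, y ^+ k = x
}.

#[short(type="idempotentSemifieldType")]
HB.structure Definition IdempotentSemifield :=
  { X of GRing.ComNzSemiRing X & isIdempotentSemifield X }.

Fact semifield_display : Order.disp_t. Proof. exact: Order.Disp tt tt. Qed.

Section SemifieldOrder.
Context {X : idempotentSemifieldType}.
Implicit Types x y z : X.

Definition sle x y := x + y == y.
Definition slt x y := (y != x) && sle x y.

Fact slt_def x y : slt x y = (y != x) && sle x y. Proof. by []. Qed.

Fact sle_refl : reflexive sle. Proof. by move=> x; rewrite /sle addss. Qed.

Fact sle_anti : antisymmetric sle.
Proof. by move=> x y /andP[/eqP xy /eqP yx]; rewrite -xy addrC yx. Qed.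

Fact sle_trans : transitive sle.
Proof.
by move=> y x z /eqP xy /eqP yz; apply/eqP; rewrite -yz addrA xy.
Qed.

Fact sle_total : total sle.
Proof.
by move=> x y; apply/orP; case: (adds_total x y) => /eqP; [left | right].
Qed.

End SemifieldOrder.

HB.instance Definition _ (X : idempotentSemifieldType) :=
  Order.isPOrder.Build semifield_display (IdempotentSemifield.sort X)
    (@slt_def X) (@sle_refl X) (@sle_anti X) (@sle_trans X).

HB.instance Definition _ (X : idempotentSemifieldType) :=
  Order.POrder_isTotal.Build semifield_display (IdempotentSemifield.sort X)
    (@sle_total X).

Lemma leEadds (X : idempotentSemifieldType) (x y : X) :
  (x <= y)%O = (x + y == y).
Proof. by []. Qed.

Section Definitions.
Context {X : idempotentSemifieldType}.
Implicit Types (m n : nat).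

Definition conj_inv (x : X) : X := if x == 0 then 0 else sinv x.

Definition conj_tr m (x : 'cV[X]_m) : 'rV[X]_m := \row_i conj_inv (x i 0).

Definition column_regular m n (A : 'M[X]_(m, n)) : Prop :=
  forall j, col j A != 0.

Definition zero_rows m (d : 'cV[X]_m) : {set 'I_m} := [set i | d i 0 == 0].

Definition zero_cols m n (A : 'M[X]_(m, n)) (d : 'cV[X]_m) : {set 'I_n} :=
  [set j | [exists i in zero_rows d, ((0 : X) < A i j)%O]].

Definition consistent m n (A : 'M[X]_(m, n)) (d : 'cV[X]_m) : Prop :=
  forall i j, i \notin zero_rows d -> j \in zero_cols A d -> A i j = 0.

(* Systems of vectors are indexed families (repetitions allowed), so that     *)
(* subsystems correspond to subsets of the index set.                         *)
Definition lin_comb m n (a : 'I_n -> 'cV[X]_m) (I : {set 'I_n})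
    (d : 'cV[X]_m) : Prop :=
  exists c : 'I_n -> X, d = \sum_(i in I) c i *: a i.

Definition min_generating m n (a : 'I_n -> 'cV[X]_m) (I : {set 'I_n})
    (d : 'cV[X]_m) : Prop :=
  [/\ forall i, i \in I -> a i != 0,
      lin_comb a I d
    & forall J : {set 'I_n}, J \proper I -> ~ lin_comb a J d].

End Definitions.

(* Main.v *)
(* Write u_j = (d^- a_j)^-.  Under the hypotheses u_j is the largest scalar c *)
(* with c a_j <= d, so the columns indexed by I generate d iff d is the       *)
(* combination with the coefficients u_j, which is a decidable condition.  In *)
(* each nonzero row of A x = d the maximum is attained at some j, which       *)
(* forces x_j = u_j; hence the indices with x_j = u_j generate d, and any     *)
(* minimal generating subset of them is the required I.                       *)

Require Import Defs.
From HB Require Import structures.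
From mathcomp Require Import all_boot all_order all_algebra.

Set Implicit Arguments.
Unset Strict Implicit.
Unset Printing Implicit Defensive.

Import Order.TTheory GRing.Theory.
Local Open Scope ring_scope.

(** Sums are maxima, so [A *m x <= d] can be tested one column at a time: [max_coef_mul_le] and
    [le_max_coef] together say that it holds exactly when every [x j 0] is at most [u j]. Equality
    needs, besides, that the columns whose coefficient equals [u j] already reach [d]; by
    [lin_comb_max_coef] this means that they generate [d], and one may shrink them to a minimal
    generating set. *)

Section SemifieldTheory.
Context {X : idempotentSemifieldType}.
Implicit Types x y z : X.

Lemma sle0x x : ((0 : X) <= x)%O.
Proof. by rewrite leEadds add0r. Qed.

Lemma slex0 x : (x <= (0 : X))%O = (x == 0).
Proof. by rewrite leEadds addr0. Qed.

Lemma sle_addl x y : (x <= x + y)%O.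
Proof. by rewrite leEadds addrA addss. Qed.

Lemma sadd_le x y z : (x <= z)%O -> (y <= z)%O -> (x + y <= z)%O.
Proof. by rewrite !leEadds -addrA => /eqP xz /eqP ->; rewrite xz. Qed.

Lemma sle_mul2r z x y : (x <= y)%O -> (x * z <= y * z)%O.
Proof. by rewrite !leEadds -mulrDl => /eqP ->. Qed.

Lemma sle_mul2l z x y : (x <= y)%O -> (z * x <= z * y)%O.
Proof. by rewrite !(mulrC z); apply: sle_mul2r. Qed.

Lemma smulfK z x : z != 0 -> x * z * sinv z = x.
Proof. by move=> z0; rewrite -mulrA mulfsV // mulr1. Qed.

Lemma sle_pmul2r z x y : z != 0 -> (x * z <= y * z)%O -> (x <= y)%O.
Proof. by move=> z0 /(sle_mul2r (sinv z)); rewrite !smulfK. Qed.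

Lemma smulf_eq0l x z : z != 0 -> x * z = 0 -> x = 0.
Proof. by move=> z0 xz0; rewrite -(smulfK x z0) xz0 mul0r. Qed.

Lemma ssum_le (T : finType) (P : pred T) (F : T -> X) z :
  (forall i, P i -> (F i <= z)%O) -> (\sum_(i | P i) F i <= z)%O.
Proof.
by move=> Fz; apply: (big_ind (fun y => (y <= z)%O)) => //;
  [apply: sle0x | move=> x y; apply: sadd_le].
Qed.

Lemma sle_sum_term (T : finType) (P : pred T) (F : T -> X) i :
  P i -> (F i <= \sum_(j | P j) F j)%O.
Proof. by move=> Pi; rewrite (bigD1 i) //= sle_addl. Qed.

(** By totality [x + y] is always [x] or [y]; being nonzero rules out the empty sum. *)
Lemma ssum_attained (T : finType) (F : T -> X) :
  \sum_i F i != 0 -> exists i, \sum_i F i = F i.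
Proof.
apply: (big_ind (fun y => y != 0 -> exists i, y = F i)) => [|x y hx hy|i _ _].
- by rewrite eqxx.
- by case: (adds_total x y) => [|]; rewrite 1?(addrC y) => ->.
- by exists i.
Qed.

End SemifieldTheory.

Section MaximalCoefficients.
Context {X : idempotentSemifieldType} {m n : nat}.
Variables (A : 'M[X]_(m, n)) (d : 'cV[X]_m).
Hypotheses (hA : column_regular A) (hAd : consistent A d).

Let w j : X := (conj_tr d *m col j A) 0 0.
Let u j := conj_inv (w j).

Let wE j : w j = \sum_i conj_inv (d i 0) * A i j.
Proof. by rewrite /w mxE; apply: eq_bigr => i _; rewrite !mxE. Qed.

Let term_le i j : (conj_inv (d i 0) * A i j <= w j)%O.
Proof. by rewrite wE (sle_sum_term (fun k => conj_inv (d k 0) * A k j)). Qed.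

Lemma max_coef_mul_le i j : (u j * A i j <= d i 0)%O.
Proof.
rewrite /u /conj_inv; have [w0|w0] := eqVneq (w j) 0.
  by rewrite mul0r sle0x.
have [di0|di0] := eqVneq (d i 0) 0.
  have [->|Aij0] := eqVneq (A i j) 0; first by rewrite mulr0 sle0x.
  (* Column [j] meets a zero row of [d], so consistency kills its entries in all other rows and
     forces [w j = 0]. *)
  case/eqP: w0; rewrite wE big1 // => k _; rewrite /conj_inv.
  have [_|dk0] := eqVneq (d k 0) 0; first by rewrite mul0r.
  rewrite (hAd (i := k) (j := j)) ?mulr0 ?inE //.
  by apply/existsP; exists i; rewrite inE di0 eqxx lt_neqAle eq_sym Aij0 sle0x.
apply: (sle_pmul2r w0); rewrite mulrAC [sinv _ * _]mulrC mulfsV // mul1r.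
have := sle_mul2l (d i 0) (term_le i j).
by rewrite /conj_inv (negPf di0) mulrA mulfsV // mul1r.
Qed.

Lemma le_max_coef c j : (forall i, c * A i j <= d i 0)%O -> (c <= u j)%O.
Proof.
move=> cd; rewrite /u /conj_inv; have [w0|w0] := eqVneq (w j) 0.
  (* Here [u j] is 0 by convention, so [c] must vanish: a nonzero entry of the column can only lie
     in a row where [d] is 0. *)
  have [i Aij0] : exists i, A i j != 0.
    apply/existsP; apply: contraNT (hA j); rewrite negb_exists => /forallP Aj0.
    by apply/eqP/colP => i; rewrite !mxE; apply/eqP; rewrite -[_ == _]negbK.
  have [di0|di0] := eqVneq (d i 0) 0.
    have := cd i; rewrite di0 !slex0 => /eqP ca0.
    by rewrite (smulf_eq0l Aij0 ca0).
  have := term_le i j; rewrite w0 slex0 /conj_inv (negPf di0) => /eqP sa0.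
  have := mulfsV _ di0; rewrite (smulf_eq0l Aij0 sa0) mulr0.
  by move=> /esym/eqP; rewrite oner_eq0.
(* It remains that [c * w j <= 1], checked term by term. *)
apply: (sle_pmul2r w0); rewrite [sinv _ * _]mulrC mulfsV // wE mulr_sumr.
apply: ssum_le => i _; rewrite /conj_inv; have [_|di0] := eqVneq (d i 0) 0.
  by rewrite mul0r mulr0 sle0x.
rewrite mulrCA -(mulfsV _ di0) [X in (_ <= X)%O]mulrC.
exact: sle_mul2l (cd i).
Qed.

(** Raising each coefficient to its maximum [u j] cannot lower the sum, nor push it above [d]. *)
Lemma lin_comb_max_coef (I : {set 'I_n}) :
  lin_comb (fun j => col j A) I d <-> d = \sum_(j in I) u j *: col j A.
Proof.
split=> [[c dE]|dE]; last by exists u.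
apply/colP => i; apply/le_anti/andP; split; last first.
  by rewrite summxE; apply: ssum_le => j _; rewrite !mxE max_coef_mul_le.
rewrite {1}dE !summxE; apply: ssum_le => j jI; rewrite !mxE.
apply: le_trans (_ : _ <= u j * A i j)%O _.
  apply/sle_mul2r/le_max_coef => k; rewrite dE summxE.
  have := sle_sum_term (fun l => (c l *: col l A) k 0) jI.
  by rewrite !mxE.
have := sle_sum_term (fun l => (u l *: col l A) i 0) jI.
by rewrite !mxE.
Qed.

End MaximalCoefficients.

Theorem theorem3 (X : idempotentSemifieldType)
    (m n : nat) (A : 'M[X]_(m, n)) (d : 'cV[X]_m)
    (hA : column_regular A) (hd : d != 0) (hAd : consistent A d)
    (x : 'cV[X]_n) :
  A *m x = d <->
  exists I : {set 'I_n},
    min_generating (fun i => col i A) I d /\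
    forall i : 'I_n,
      (i \in I -> x i 0 = conj_inv ((conj_tr d *m col i A) 0 0)) /\
      (i \notin I -> (x i 0 <= conj_inv ((conj_tr d *m col i A) 0 0))%O).
Proof.
pose u j := conj_inv ((conj_tr d *m col j A) 0 0).
have genE := lin_comb_max_coef hA hAd.
split=> [Axd|[I [[_ /genE dE _] hx]]]; last first.
  (* The bounds give [A *m x <= d]; the terms with index in [I] alone already sum to [d]. *)
  apply/colP => i; rewrite mxE; apply/le_anti/andP; split.
    apply: ssum_le => j _; apply: le_trans (max_coef_mul_le hAd i j).
    rewrite mulrC; apply: sle_mul2r.
    by have [jI|jI] := boolP (j \in I); [rewrite (hx j).1 | apply: (hx j).2].
  rewrite {1}dE summxE; apply: ssum_le => j jI; rewrite mxE -(hx j).1 //.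
  by rewrite mxE mulrC (sle_sum_term (fun l => A i l * x l 0)).
have AxE i : \sum_j A i j * x j 0 = d i 0 by rewrite -Axd mxE.
have xu j : (x j 0 <= u j)%O.
  apply: (le_max_coef hA) => i; rewrite mulrC -AxE.
  exact: (sle_sum_term (fun l => A i l * x l 0)).
(* A boolean form of generation, as [minset_exists] requires. *)
pose gen (I : {set 'I_n}) := d == \sum_(j in I) u j *: col j A.
have genS : gen [set j | x j 0 == u j].
  apply/eqP/colP => i; apply/le_anti/andP; split; last first.
    by rewrite summxE; apply: ssum_le => j _; rewrite 2!mxE max_coef_mul_le.
  have [->|di0] := eqVneq (d i 0) 0; first exact: sle0x.
  have [j dij] : exists j, \sum_j A i j * x j 0 = A i j * x j 0.
    by apply: ssum_attained; rewrite AxE.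
  rewrite AxE in dij.
  have Aij0 : A i j != 0 by apply: contraNneq di0 => A0; rewrite dij A0 mul0r.
  (* Cancelling [A i j] in [u j * A i j <= d i 0 = A i j * x j 0] gives [u j <= x j 0]. *)
  have xju : x j 0 == u j.
    rewrite eq_le xu; apply: (sle_pmul2r Aij0).
    by rewrite [X in (_ <= X)%O]mulrC -dij max_coef_mul_le.
  rewrite summxE dij mulrC (eqP xju).
  have := sle_sum_term (P := [in [set j | x j 0 == u j]])
    (fun l => (u l *: col l A) i 0) (i := j).
  by rewrite inE !mxE; apply.
have [I /minsetP[/eqP genI minI] /subsetP sIS] := minset_exists genS.
exists I; split; last first.
  by move=> j; split=> [/sIS|_]; [rewrite inE => /eqP | apply: xu].
split=> [j _|| J JI /genE genJ]; [exact: hA | exact/genE |].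
move: (JI); rewrite -(minI J) ?properxx //; first exact/eqP.
exact: proper_sub.
Qed.
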